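(* Let $P_1,\dots,P_n$ be discrete probability measures on $\mathbb{R}^d$ with weights $\lambda_1,\dots,\lambda_n>0$, $\sum_i\lambda_i=1$, and let $S^*$ be the set of all combinations of their support points. Let a set of possible combinations $S_0^*\subseteq S^*$ be given, together with an optimal fixed-support approximation of the barycenter problem over $S_0^*$ (an optimal solution of the restricted barycenter linear program over $S_0^*$), and let $y=(y_{ik})$ be the corresponding dual vector. Consider the integer program (Gen-IP) in the variables $z_{ik}$ ($1\le i\le n$, $1\le k\le |P_i|$) and $z_{ijkm}$ ($1\le i<j\le n$, $1\le k\le |P_i|$, $1\le m\le |P_j|$): $$\max\ \sum_{i=1}^n\sum_{k=1}^{|P_i|} y_{ik}z_{ik}-\sum_{i=1}^{n-1}\sum_{j=i+1}^n\sum_{k=1}^{|P_i|}\lambda_i\lambda_j\,\mathbf{x}_{ik}^T\mathbf{x}_{ik}\,z_{ik}-\sum_{i=1}^{n-1}\sum_{j=i+1}^n\sum_{m=1}^{|P_j|}\lambda_i\lambda_j\,\mathbf{x}_{jm}^T\mathbf{x}_{jm}\,z_{jm}+2\sum_{i=1}^{n-1}\sum_{j=i+1}^n\sum_{k=1}^{|P_i|}\sum_{m=1}^{|P_j|}\lambda_i\lambda_j\,\mathbf{x}_{ik}^T\mathbf{x}_{jm}\,z_{ijkm}$$ subject to $\sum_{k=1}^{|P_i|}z_{ik}=1$ for all $i$; $z_{ijkm}\le z_{ik}$, $z_{ijkm}\le z_{jm}$ and $z_{ijkm}\ge z_{ik}+z_{jm}-1$ for all $i<j$, $k$, $m$; and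 all variables $z_{ik},z_{ijkm}\in\{0,1\}$. Then (Gen-IP) finds a new combination of best reduced cost from the set of all combinations $S^*$. That is, for an optimal solution $\mathbf{z}$ of (Gen-IP), letting $k_i$ be the unique index with $z_{ik_i}=1$, the combination $s_{h^*}=(\mathbf{x}_{1k_1},\dots,\mathbf{x}_{nk_n})\in S^*$ is new, i.e. $s_{h^*}\notin S_0^*$, and satisfies $$y^TA_{h^*}-c_{h^*}=\max_{s_h\in S^*}\left(y^TA_h-c_h\right).$$
   Context: Each $P_i$ is a probability measure on $\mathbb{R}^d$ with finitely many support points $\mathbf{x}_{i1},\dots,\mathbf{x}_{i|P_i|}$ (distinct), where $|P_i|$ is the number of support points; the mass at $\mathbf{x}_{ik}$ is $d_{ik}>0$ and $\sum_k d_{ik}=1$. A combination is a tuple $s_h=(\mathbf{x}_1^h,\dots,\mathbf{x}_n^h)$ choosing one support point $\mathbf{x}_i^h$ of $P_i$ for each $i$. The set $S^*$ of all combinations has $\prod_{i=1}^n|P_i|$ elements. The unit transport cost of $s_h$ is $$c_h=\sum_{i=1}^{n-1}\lambda_i\sum_{j=i+1}^n\lambda_j\|\mathbf{x}_i^h-\mathbf{x}_j^h\|^2 .$$ Let $A_h$ be the $0,1$-vector indexed by pairs $(i,k)$, $1\le i\le n$, $1\le k\le|P_i|$, with entry $1$ at $(i,k)$ if and only if $\mathbf{x}_i^h=\mathbf{x}_{ik}$. The restricted barycenter linear program (fixed-support approximation) over $S_0^*\subseteq S^*$ is $$\min\sum_{s_h\in S_0^*}c_hw_h\quad\text{s.t.}\quad\sum_{s_h\in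 S_0^*}A_hw_h=(d_{ik}),\quad w_h\ge0 .$$ The dual vector $y=(y_{ik})$ is an optimal solution of its linear programming dual: maximize $\sum_{i,k}d_{ik}y_{ik}$ subject to $y^TA_h\le c_h$ for all $s_h\in S_0^*$, $y$ free. The reduced cost of $s_h$ is $c_h-y^TA_h$; best reduced cost means that $c_h-y^TA_h$ is minimal, equivalently $y^TA_h-c_h$ is maximal.
   Formalization: That the combination found is new (not in S_0^* ) is claimed only when some combination in S^* has negative reduced cost; without this the claim is false, e.g. when S_0^* = S^*. Existence of an optimal solution of (Gen-IP) is also proved. *)

(* Defs.v *)
From HB Require Import structures.
From mathcomp Require Import all_boot all_order all_algebra.
From mathcomp Require Import reals.

Set Implicit Arguments.
Unset Strict Implicit.
Unset Printing Implicit Defensive.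

Import Order.TTheory GRing.Theory Num.Theory.
Local Open Scope ring_scope.

(* x^T y *)
Definition dotp (R : realType) (d : nat) (x y : 'cV[R]_d) : R :=
  (x^T *m y) 0 0.

(* The Euclidean norm; the norm `|x| that the library puts on matrices is the
   sup norm. *)
Definition enorm (R : realType) (d : nat) (x : 'cV[R]_d) : R :=
  Num.sqrt (dotp x x).

(* A finitely supported probability measure on R^d, given by its distinct
   support points and their masses. Nonemptiness of the support follows from
   mass_sum1. *)
Record discrete_prob (R : realType) (d : nat) := DiscreteProb {
  nsupp : nat;
  point : 'I_nsupp -> 'cV[R]_d;
  mass : 'I_nsupp -> R;
  point_inj : injective point;
  mass_gt0 : forall k, 0 < mass k;
  mass_sum1 : \sum_k mass k = 1
}.

Section Barycenter.
Variables (R : realType) (d n : nat) (P : 'I_n -> discrete_prob R d).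
Variable lam : 'I_n -> R.

(* A tuple of support points is represented by the tuple of their indices,
   which is faithful because the points of each measure are distinct. The
   whole finite type plays the role of S^*. *)
Definition combination := {dffun forall i : 'I_n, 'I_(nsupp (P i))}.

Definition comb_point (s : combination) (i : 'I_n) : 'cV[R]_d :=
  point (s i).

Definition cost (s : combination) : R :=
  \sum_(i < n) lam i *
    \sum_(j < n | (i < j)%N) lam j *
      enorm (comb_point s i - comb_point s j) ^+ 2.

(* Vectors indexed by the pairs (i, k) with k < |P_i|. *)
Definition supp_vec := forall i : 'I_n, 'I_(nsupp (P i)) -> R.

(* Vectors indexed by (i, j, k, m); only the entries with i < j are variables
   of the integer program, the others occur in no constraint and not in the
   objective. *)
Definition pair_vec :=
  forall i j : 'I_n, 'I_(nsupp (P i)) -> 'I_(nsupp (P j)) -> R.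

Definition incidence (s : combination) : supp_vec :=
  fun i k => (comb_point s i == point k)%:R.

(* y^T A_s *)
Definition dual_value (y : supp_vec) (s : combination) : R :=
  \sum_(i < n) \sum_(k < nsupp (P i)) y i k * incidence s k.

Definition reduced_cost (y : supp_vec) (s : combination) : R :=
  cost s - dual_value y s.

(* In the restricted program only the entries of w on S0 are variables. *)
Definition lp_feasible (S0 : {set combination}) (w : combination -> R) : Prop :=
  (forall (i : 'I_n) (k : 'I_(nsupp (P i))),
     \sum_(s in S0) incidence s k * w s = mass k) /\
  (forall s, s \in S0 -> 0 <= w s).

Definition lp_objective (S0 : {set combination}) (w : combination -> R) : R :=
  \sum_(s in S0) cost s * w s.

Definition lp_optimal (S0 : {set combination}) (w : combination -> R) : Prop :=
  lp_feasible S0 w /\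
  forall w', lp_feasible S0 w' -> lp_objective S0 w <= lp_objective S0 w'.

Definition dual_feasible (S0 : {set combination}) (y : supp_vec) : Prop :=
  forall s, s \in S0 -> dual_value y s <= cost s.

Definition dual_objective (y : supp_vec) : R :=
  \sum_(i < n) \sum_(k < nsupp (P i)) mass k * y i k.

Definition dual_optimal (S0 : {set combination}) (y : supp_vec) : Prop :=
  dual_feasible S0 y /\
  forall y', dual_feasible S0 y' -> dual_objective y' <= dual_objective y.

Definition genip_objective (y : supp_vec) (z : supp_vec) (zz : pair_vec) : R :=
  \sum_(i < n) \sum_(k < nsupp (P i)) y i k * z i k
  - \sum_(i < n) \sum_(j < n | (i < j)%N) \sum_(k < nsupp (P i))
      lam i * lam j * dotp (point k) (point k) * z i k
  - \sum_(i < n) \sum_(j < n | (i < j)%N) \sum_(m < nsupp (P j))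
      lam i * lam j * dotp (point m) (point m) * z j m
  + 2 * \sum_(i < n) \sum_(j < n | (i < j)%N)
          \sum_(k < nsupp (P i)) \sum_(m < nsupp (P j))
      lam i * lam j * dotp (point k) (point m) * zz i j k m.

Record genip_feasible (z : supp_vec) (zz : pair_vec) : Prop := GenIPFeasible {
  genip_sum1 : forall i : 'I_n, \sum_(k < nsupp (P i)) z i k = 1;
  genip_lel : forall (i j : 'I_n) k m, (i < j)%N -> zz i j k m <= z i k;
  genip_ler : forall (i j : 'I_n) k m, (i < j)%N -> zz i j k m <= z j m;
  genip_ge : forall (i j : 'I_n) k m, (i < j)%N ->
    z i k + z j m - 1 <= zz i j k m;
  genip_bin1 : forall i k, z i k = 0 \/ z i k = 1;
  genip_bin2 : forall (i j : 'I_n) k m, (i < j)%N ->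
    zz i j k m = 0 \/ zz i j k m = 1
}.

Definition genip_optimal (y : supp_vec) (z : supp_vec) (zz : pair_vec) : Prop :=
  genip_feasible z zz /\
  forall z' zz', genip_feasible z' zz' ->
    genip_objective y z' zz' <= genip_objective y z zz.

End Barycenter.

(* Main.v *)
(* The constraints of (Gen-IP) force z to be the indicator of one combination s
   and z_ijkm to be the product z_ik z_jm, so feasible points correspond
   bijectively to combinations. Expanding the squared distances, the objective
   at the point of s equals y^T A_s - c_s. If some combination has negative
   reduced cost, so has the optimal one, which by dual feasibility is then not
   in S0. *)
Require Import Defs.
From HB Require Import structures.
From mathcomp Require Import all_boot all_order all_algebra.
From mathcomp Require Import reals.
From mathcomp Require Import ring.

Set Implicit Arguments.
Unset Strict Implicit.
Unset Printing Implicit Defensive.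

Import Order.TTheory GRing.Theory Num.Theory.
Local Open Scope ring_scope.

Lemma sum_mulr_delta (R : realType) (T : finType) (f : T -> R) (a : T) :
  \sum_k f k * (k == a)%:R = f a.
Proof.
rewrite (bigD1 a) //= eqxx mulr1 big1 ?addr0 // => k /negPf ->.
by rewrite mulr0.
Qed.

(** Once [f a] uses up the whole sum, the other values are nonnegative with sum zero, so each of
    them vanishes. *)
Lemma binary_sum1_delta (R : realType) (T : finType) (f : T -> R) (a : T) :
  (forall k, f k = 0 \/ f k = 1) -> \sum_k f k = 1 -> f a = 1 ->
  forall k, f k = (k == a)%:R.
Proof.
move=> f01; rewrite (bigD1 a) //= => + fa1; rewrite fa1 => /eqP.
rewrite -[X in _ == X]addr0 (inj_eq (addrI _)) psumr_eq0; last first.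
  by move=> k _; case: (f01 k) => ->.
move=> /allP f0 k; have [->|ka] := eqVneq k a; first exact: fa1.
by have /implyP/(_ ka)/eqP := f0 k (mem_index_enum k).
Qed.

Lemma binary_sum1_exists (R : realType) (T : finType) (f : T -> R) :
  (forall k, f k = 0 \/ f k = 1) -> \sum_k f k = 1 -> exists a, f a = 1.
Proof.
move=> f01 f1; case: (pickP (fun k => f k == 1)) => [a /eqP fa|f0].
  by exists a.
move: f1; rewrite big1 => [/eqP|k _]; first by rewrite eq_sym oner_eq0.
by have := f0 k; case: (f01 k) => ->; rewrite ?eqxx.
Qed.

Lemma sqr_enormB (R : realType) (d : nat) (x y : 'cV[R]_d) :
  enorm (x - y) ^+ 2 = dotp x x + dotp y y - 2 * dotp x y.
Proof.
have dotpE (u v : 'cV[R]_d) : dotp u v = \sum_k u k 0 * v k 0.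
  by rewrite /dotp mxE; apply: eq_bigr => k _; rewrite mxE.
(* The square cancels the root because [dotp] of a vector with itself is a sum of squares. *)
rewrite /enorm sqr_sqrtr; last first.
  by rewrite dotpE sumr_ge0 // => k _; rewrite -expr2 sqr_ge0.
rewrite !dotpE mulr_sumr -big_split -sumrB; apply: eq_bigr => k _ /=.
by rewrite !mxE; ring.
Qed.

Section GenIP.
Variables (R : realType) (d n : nat) (P : 'I_n -> discrete_prob R d).
Variables (lam : 'I_n -> R) (y : supp_vec P).
Implicit Types (s : combination P) (z : supp_vec P) (zz : pair_vec P).

(** An empty support would have total mass 0 instead of 1. The element serves as the starting point
    of the arg max below. *)
Lemma combination_exists : inhabited (combination P).
Proof.
have supp_gt0 i : (0 < nsupp (P i))%N.
  rewrite lt0n; apply/eqP => P0; have := mass_sum1 (P i).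
  rewrite big1 => [/eqP|k _]; first by rewrite eq_sym oner_eq0.
  by exfalso; have := leq_ltn_trans (leq0n k) (ltn_ord k); rewrite P0.
by constructor; exact: [ffun i => Ordinal (supp_gt0 i)].
Qed.

Definition comb_z s : supp_vec P := fun i k => (k == s i)%:R.

Definition comb_zz s : pair_vec P := fun i j k m => comb_z s k * comb_z s m.

Lemma comb_feasible s : genip_feasible (comb_z s) (comb_zz s).
Proof.
split; rewrite /comb_zz /comb_z.
- move=> i; rewrite -[RHS](sum_mulr_delta (fun=> 1) (s i)).
  by apply: eq_bigr => k _; rewrite mul1r.
- by move=> i j k m _; do 2!case: eqP => _; rewrite ?mulr0 ?mulr1.
- by move=> i j k m _; do 2!case: eqP => _; rewrite ?mul0r ?mul1r.
- move=> i j k m _; do 2!case: eqP => _;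
    by rewrite /= ?mulr0 ?mulr1 ?addr0 ?add0r ?addrK ?subrr ?oppr_le0 ?ler01.
- by move=> i k; case: eqP; [right | left].
- move=> i j k m _; rewrite -natrM mulnb.
  by case: andP; [right | left].
Qed.

Lemma genip_feasible_z z zz s : genip_feasible z zz ->
  (forall i, z i (s i) = 1) -> forall i k, z i k = comb_z s k.
Proof.
move=> fz zs i; apply: binary_sum1_delta (zs i); last exact: genip_sum1 fz i.
exact: genip_bin1 fz i.
Qed.

(** If a factor is 0, its upper bound forces the binary [zz i j k m] to be 0; if both are 1, the
    lower bound forces it to be 1. *)
Lemma genip_feasible_zz z zz (i j : 'I_n) k m : genip_feasible z zz ->
  (i < j)%N -> zz i j k m = z i k * z j m.
Proof.
move=> fz ij; apply/eqP.
have := genip_ge fz k m ij; have := genip_ler fz k m ij.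
have := genip_lel fz k m ij.
have := genip_bin2 fz k m ij.
case: (genip_bin1 fz k) => ->; case: (genip_bin1 fz m) => ->;
  case=> ->; rewrite ?mulr0 ?mul0r ?mulr1 ?eqxx ?ler10 //.
by rewrite addrK ler10.
Qed.

(** Support points are distinct, so equality of points in [incidence] is equality of indices. *)
Lemma dual_valueE s : dual_value y s = \sum_i y (s i).
Proof.
apply: eq_bigr => i _; rewrite -(sum_mulr_delta (y (i := i))).
apply: eq_bigr => k _; rewrite /incidence /comb_point.
by rewrite (inj_eq (@point_inj _ _ _)) eq_sym.
Qed.

Lemma genip_objectiveE z zz s : genip_feasible z zz ->
  (forall i, z i (s i) = 1) ->
  genip_objective lam y z zz = dual_value y s - cost lam s.
Proof.
move=> fz zs; have zE := genip_feasible_z fz zs.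
have sumz i (f : 'I_(nsupp (P i)) -> R) : \sum_k f k * z i k = f (s i).
  by rewrite -[RHS]sum_mulr_delta; apply: eq_bigr => k _; rewrite zE.
rewrite dual_valueE /genip_objective -!addrA; congr (_ + _).
  by apply: eq_bigr => i _; rewrite sumz.
(* Both sides are negated, so that the quadratic terms can be matched with [cost] pair by pair over
   [i < j]. *)
rewrite mulr_sumr addrA -opprD -big_split /= -[LHS]opprK.
congr (- _); rewrite opprD opprK -sumrB; apply: eq_bigr => i _.
rewrite mulr_sumr -big_split /= mulr_sumr -sumrB; apply: eq_bigr => j ij.
rewrite !sumz sqr_enormB /comb_point.
(* Since [zz] is a product of two indicators, summing over [m] and then over [k] selects the single
   cross term at [s i], [s j]. *)
have -> : \sum_k \sum_m lam i * lam j * dotp (point k) (point m) * zz i j k m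
    = lam i * lam j * dotp (point (s i)) (point (s j)).
  rewrite -[RHS](sumz i (fun k => lam i * lam j * dotp (point k) (point (s j)))).
  apply: eq_bigr => k _.
  rewrite -(sumz j (fun m => lam i * lam j * dotp (point k) (point m))).
  rewrite mulr_suml; apply: eq_bigr => m _.
  by rewrite (genip_feasible_zz k m fz ij); ring.
by ring.
Qed.

Lemma genip_feasible_comb z zz : genip_feasible z zz ->
  exists s, forall i, z i (s i) = 1.
Proof.
move=> fz.
have z1 i : exists k, z i k == 1.
  have [k zk] := binary_sum1_exists (genip_bin1 fz (i := i)) (genip_sum1 fz i).
  by exists k; apply/eqP.
exists [ffun i => xchoose (z1 i)] => i.
by rewrite ffunE; apply/eqP; exact: xchooseP (z1 i).
Qed.

Lemma comb_z1 s i : comb_z s (s i) = 1.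
Proof. by rewrite /comb_z eqxx. Qed.

(** There are finitely many combinations, so one maximizes [dual_value] minus [cost]; its indicator
    is optimal, as every feasible point comes from a combination. *)
Lemma genip_optimal_exists : exists z zz, genip_optimal lam y z zz.
Proof.
have [s0] := combination_exists.
pose s := [arg max_(t > s0) (dual_value y t - cost lam t)]%O.
exists (comb_z s), (comb_zz s); split=> [|z zz fz]; first exact: comb_feasible.
have [t zt] := genip_feasible_comb fz.
rewrite (genip_objectiveE fz zt).
rewrite (genip_objectiveE (comb_feasible s) (comb_z1 s)).
by rewrite /s; case: arg_maxP => // u _; apply.
Qed.

Lemma genip_optimal_best z zz s : genip_optimal lam y z zz ->
  (forall i, z i (s i) = 1) ->
  forall s', dual_value y s' - cost lam s' <= dual_value y s - cost lam s.
Proof.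
move=> [fz opt] zs s'; rewrite -(genip_objectiveE fz zs).
by rewrite -(genip_objectiveE (comb_feasible s') (comb_z1 s')) opt //;
  exact: comb_feasible.
Qed.

End GenIP.

Theorem theorem1 (R : realType) (d n : nat)
    (P : 'I_n -> discrete_prob R d) (lam : 'I_n -> R)
    (lam_gt0 : forall i, 0 < lam i) (lam_sum1 : \sum_(i < n) lam i = 1)
    (S0 : {set combination P}) (w : combination P -> R) (y : supp_vec P)
    (w_opt : lp_optimal lam S0 w) (y_opt : dual_optimal lam S0 y) :
  (exists z zz, genip_optimal lam y z zz) /\
  forall (z : supp_vec P) (zz : pair_vec P), genip_optimal lam y z zz ->
    (forall i, exists! k, z i k = 1) /\
    forall s : combination P, (forall i, z i (s i) = 1) ->
      (forall s' : combination P,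
         dual_value y s' - cost lam s' <= dual_value y s - cost lam s) /\
      ((exists s' : combination P, reduced_cost lam y s' < 0) -> s \notin S0).
Proof.
split=> [|z zz opt]; first exact: genip_optimal_exists.
have [fz _] := opt; split=> [i|s zs].
  have [s zs] := genip_feasible_comb fz; exists (s i); split=> // k /eqP.
  rewrite (genip_feasible_z fz zs) /comb_z.
  by have [->|_] := eqVneq k (s i); rewrite // eq_sym oner_eq0.
have best := genip_optimal_best opt zs; split=> // -[s' s'_lt0].
(* Membership in [S0] would make the reduced cost of [s] nonnegative, yet it is at most that of
   [s'], which is negative. *)
apply/negP => /(proj1 y_opt); rewrite -subr_le0 leNgt => /negP; apply.
by apply: lt_le_trans (best s'); rewrite -opprB oppr_gt0.
Qed.
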